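(* Let $G$ be a treelike comparability graph. Then $G$ has no induced subgraph isomorphic to the cycle $C_4$ if and only if $G$ does not contain a strict-double-arborescence as an induced subgraph.
   Context: A graph is a comparability graph if it admits a transitive orientation. A treelike comparability graph is one admitting a transitive orientation (its treelike orientation) whose Hasse diagram (transitive reduction), as an undirected graph, is a tree. A double-arborescence is a treelike comparability graph $G=(V,E)$ with a vertex $r$ (a root) such that $V=\{r\}\cup N_G(r)$; it is an arborescence if, under the treelike orientation, a root is a source (indegree zero) or a sink (outdegree zero). A strict-double-arborescence is a double-arborescence that is not an arborescence. *)

(* Defs.v *)
From mathcomp Require Import all_boot.

Set Implicit Arguments.
Unset Strict Implicit.
Unset Printing Implicit Defensive.

Record sgraph := SGraph {
  vertex :> finType;
  edge : rel vertex;
  edge_sym : symmetric edge;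
  edge_irr : irreflexive edge
}.

Definition nbhd (G : sgraph) (x : G) : {set G} := [set y | edge x y].

Definition isomorphic (G H : sgraph) : Prop :=
  exists2 f : G -> H, bijective f & forall x y, edge (f x) (f y) = edge x y.

Section Induced.
Variables (G : sgraph) (S : {set G}).

Definition induced_edge : rel {x : G | x \in S} :=
  fun x y => edge (val x) (val y).

Lemma induced_edge_sym : symmetric induced_edge.
Proof. by move=> x y; apply: edge_sym. Qed.

Lemma induced_edge_irr : irreflexive induced_edge.
Proof. by move=> x; apply: edge_irr. Qed.

Definition induced : sgraph := SGraph induced_edge_sym induced_edge_irr.

End Induced.

Definition C4_edge : rel 'I_4 :=
  fun i j => (j == i.+1 %[mod 4]) || (i == j.+1 %[mod 4]).

Lemma C4_edge_sym : symmetric C4_edge.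
Proof. by move=> i j; rewrite /C4_edge orbC. Qed.

Lemma C4_edge_irr : irreflexive C4_edge.
Proof. by case=> [[|[|[|[|i]]]] Hi]. Qed.

Definition C4 : sgraph := SGraph C4_edge_sym C4_edge_irr.

Definition connected (G : sgraph) : Prop :=
  0 < #|G| /\ forall x y : G, connect (@edge G) x y.

Definition acyclic (G : sgraph) : Prop :=
  forall p : seq G, 2 < size p -> ~ ucycle (@edge G) p.

Definition tree (G : sgraph) : Prop := connected G /\ acyclic G.

(* [o x y] means that the edge [xy] is directed from [x] to [y]. *)
Definition orientation (G : sgraph) (o : rel G) : Prop :=
  (forall x y, edge x y = o x y || o y x) /\
  (forall x y, ~~ (o x y && o y x)).

Definition transitive_orientation (G : sgraph) (o : rel G) : Prop :=
  orientation o /\ transitive o.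

Section Hasse.
Variables (T : finType) (o : rel T).

Definition covers (x y : T) : bool := o x y && ~~ [exists z, o x z && o z y].

(* The test [x != y] is redundant when [o] is irreflexive, as every orientation
   is; it makes the underlying undirected graph simple for arbitrary [o]. *)
Definition hasse_edge : rel T :=
  fun x y => (x != y) && (covers x y || covers y x).

Lemma hasse_edge_sym : symmetric hasse_edge.
Proof. by move=> x y; rewrite /hasse_edge eq_sym orbC. Qed.

Lemma hasse_edge_irr : irreflexive hasse_edge.
Proof. by move=> x; rewrite /hasse_edge eqxx. Qed.

Definition hasse_diagram : sgraph := SGraph hasse_edge_sym hasse_edge_irr.

Definition indegree (x : T) : nat := #|[set y | o y x]|.
Definition outdegree (x : T) : nat := #|[set y | o x y]|.
Definition source (x : T) : Prop := indegree x = 0.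
Definition sink (x : T) : Prop := outdegree x = 0.

End Hasse.

Definition treelike_orientation (G : sgraph) (o : rel G) : Prop :=
  transitive_orientation o /\ tree (hasse_diagram o).

Definition treelike_comparability_graph (G : sgraph) : Prop :=
  exists o : rel G, treelike_orientation o.

Definition is_root (G : sgraph) (r : G) : Prop := [set: G] = r |: nbhd r.

Definition double_arborescence (G : sgraph) : Prop :=
  treelike_comparability_graph G /\ exists r : G, is_root r.

(* Neither the treelike orientation nor the root need be unique: some choice of
   both must make the root a source or a sink. *)
Definition arborescence (G : sgraph) : Prop :=
  double_arborescence G /\
  exists (o : rel G) (r : G),
    [/\ treelike_orientation o, is_root r & source o r \/ sink o r].

Definition strict_double_arborescence (G : sgraph) : Prop :=
  double_arborescence G /\ ~ arborescence G.

(* Main.v *)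
Require Import Defs.
From mathcomp Require Import all_boot.

Set Implicit Arguments.
Unset Strict Implicit.
Unset Printing Implicit Defensive.

(** If a, c < b, d induce a C4 in an order whose Hasse diagram is a forest, then
    some r lies above a, c and below b, d; together these five vertices induce a
    strict-double-arborescence, since by the same fact the root of the wheel
    over C4 is neither a source nor a sink of any treelike orientation.
    Conversely, in a double-arborescence with root r and no induced C4, the
    elements below r or those above r form a chain, whose extremal element is
    then a root that is a source or a sink. *)

(** * Finite strict orders: minimal elements and chains of covers *)

Section StrictOrder.
Variables (T : finType) (o : rel T).
Hypotheses (o_irr : irreflexive o) (o_trans : transitive o).

(** Among the elements of [P] at or below [x], one with the fewest predecessors is minimal: anything
    of [P] below it would have strictly fewer. *)
Lemma exists_minimal_below (P : pred T) x : P x ->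
  exists m, [/\ P m, (m == x) || o m x & forall z, P z -> ~~ o z m].
Proof.
move=> Px; pose Q z := P z && ((z == x) || o z x).
have Qx : Q x by rewrite /Q Px eqxx.
case: (arg_minnP (fun z => #|[set y | o y z]|) Qx) => m /andP[Pm lemx] minm.
exists m; split=> // z Pz; apply/negP => ozm.
have Qz : Q z.
  rewrite /Q Pz /=; case/orP: lemx => [/eqP <-|omx]; first by rewrite ozm orbT.
  by rewrite (o_trans ozm omx) orbT.
have := minm z Qz; rewrite leqNgt => /negP; apply; apply/proper_card/properP.
split; first by apply/subsetP => y; rewrite !inE => /o_trans; apply.
by exists z; rewrite inE ?o_irr.
Qed.

(** Induction on the size of the open interval: an element strictly between splits it into two
    smaller ones. Keeping every step inside the interval later shows that the path avoids a given
    Hasse edge. *)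
Lemma connect_covers x y : o x y ->
  connect [rel u v | [&& covers o u v, (x == u) || o x u & (v == y) || o v y]]
    x y.
Proof.
have [n] := ubnP #|[set z | o x z && o z y]|.
elim: n x y => // n IHn x y leI oxy.
have [/existsP[z /andP[oxz ozy]]|ncov] := boolP [exists z, o x z && o z y];
  last by apply: connect1; rewrite /= /covers oxy ncov !eqxx.
have subI (u v : T) : o u v || (u == v) -> o v z || (v == z) -> o u z || (u == z).
  by case/orP=> [ouv|/eqP->//] /orP[/(o_trans ouv)->|/eqP <-]; rewrite ?ouv.
apply: (@connect_trans _ _ z).
- apply: connect_sub (IHn x z _ oxz) => [u v /and3P[cuv xu vz]|].
    apply: connect1; rewrite /= cuv xu /=; apply/orP; right.
    by case/orP: vz => [/eqP->//|ovz]; apply: o_trans ozy.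
  rewrite -ltnS; apply: leq_trans leI; rewrite ltnS.
  apply/proper_card/properP; split.
    by apply/subsetP=> t; rewrite !inE => /andP[-> /o_trans]; apply.
  by exists z; rewrite !inE ?oxz ?o_irr.
- apply: connect_sub (IHn z y _ ozy) => [u v /and3P[cuv zu vy]|].
    apply: connect1; rewrite /= cuv vy andbT; apply/orP; right.
    by case/orP: zu => [/eqP<-//|ozu]; apply: o_trans ozu.
  rewrite -ltnS; apply: leq_trans leI; rewrite ltnS.
  apply/proper_card/properP; split.
    by apply/subsetP=> t; rewrite !inE => /andP[/(o_trans oxz)-> ->].
  by exists z; rewrite !inE ?oxz ?ozy ?o_irr.
Qed.

End StrictOrder.

(** Shortened to distinct vertices, such a path has at least three of them, and the edge [uv] closes
    it into a cycle. *)
Lemma acyclic_bridge (G : sgraph) (u v : G) : acyclic G -> edge u v ->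
  ~ connect [rel x y | edge x y && ([set x; y] != [set u; v])] u v.
Proof.
move=> acG euv /connectP[q /shortenP[p path_p uniq_p _] vE].
case: p path_p uniq_p vE => [|x [|y p]] path_p uniq_p vE.
- by move: euv; rewrite vE edge_irr.
- by move: path_p; rewrite vE /= eqxx andbF.
apply: (acG (u :: x :: y :: p)) => //; rewrite /ucycle uniq_p andbT.
rewrite (cycle_path u) /= -[last y p]vE edge_sym euv /=.
by apply: sub_path path_p => s t /andP[].
Qed.

(** * Crossings and squares in a treelike orientation *)

Section TreelikeOrientation.
Variables (G : sgraph) (o : rel G).
Hypothesis treelike_o : treelike_orientation o.

Lemma treelike_edgeE x y : edge x y = o x y || o y x.
Proof. by case: treelike_o => [[[]]]. Qed.

Lemma treelike_asym x y : o x y -> o y x = false.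
Proof.
case: treelike_o => [[[_ /(_ x y) + _] _]] => /negP asym oxy.
by apply/negP => oyx; apply: asym; rewrite oxy.
Qed.

Lemma treelike_irr : irreflexive o.
Proof. by move=> x; apply/negP => oxx; move: (treelike_asym oxx); rewrite oxx. Qed.

Lemma treelike_trans : transitive o.
Proof. by case: treelike_o => [[]]. Qed.

(* Otherwise take a' >= a maximal below b and d, and x covering a' with x <= b:
   the walk a', d, c, b, x avoids the Hasse edge a'x, which would lie on a
   cycle. *)
Lemma crossing_has_center a b c d :
  o a b -> o c b -> o c d -> o a d -> ~~ edge a c -> ~~ edge b d ->
  a != c -> b != d ->
  exists r, [/\ o a r, o c r, o r b & o r d].
Proof.
move=> oab ocb ocd oad; rewrite !treelike_edgeE !negb_or.
move=> /andP[noac noca] /andP[nobd nodb] neac nebd.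
have o_tr := treelike_trans.
have rev_irr : irreflexive (fun x y => o y x) by move=> x; apply: treelike_irr.
have rev_trans : transitive (fun x y => o y x).
  by move=> y x z oyx ozy; apply: o_tr oyx.
have Pa : o a b && o a d by rewrite oab.
case: (exists_minimal_below rev_irr rev_trans
         (P := fun z => o z b && o z d) Pa) => a' [/andP[oa'b oa'd] leaa' maxa'].
(* If [c] is below [a'], then [a'] itself is the centre; it differs from [a] because [a] and [c] are
   incomparable. *)
have [oca'|noca'] := boolP (o c a').
  exists a'; split=> //; case/orP: leaa' => [/eqP a'E|//].
  by rewrite -a'E oca' in noca.
have nca' : c != a'.
  case/orP: leaa' => [/eqP->|oaa']; first by rewrite eq_sym.
  by apply: contraNneq noac => ->.
have Qb : o a' b && ((b == b) || o b b) by rewrite oa'b eqxx.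
case: (exists_minimal_below treelike_irr o_tr
  (P := fun z => o a' z && ((z == b) || o z b)) Qb) => x
  [/andP[oa'x lexb] _ minx].
have covx : covers o a' x.
  rewrite /covers oa'x; apply/existsP => -[z /andP[oa'z ozx]].
  apply: (negP (minx z _) ozx); rewrite oa'z /=; apply/orP; right.
  by case/orP: lexb => [/eqP<-|/(o_tr _ _ _ ozx)].
have [_ [_ acH]] := treelike_o.
have hx : hasse_edge o a' x.
  rewrite /hasse_edge covx andbT; apply: contraTneq oa'x => ->.
  by rewrite treelike_irr.
case: (@acyclic_bridge (hasse_diagram o) a' x acH hx).
set E := [rel _ _ | _].
have E_sym : connect_sym E.
  apply: sym_connect_sym => s t; rewrite /E /= /edge /= hasse_edge_sym.
  by rewrite [[set s; t]]setUC.
(* A chain of covers from [u] to [v] stays between them, so it can use the edge [a'x] only if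
   [u <= a'] and [x <= v]. *)
have conn u v : o u v -> ~~ (((u == a') || o u a') && ((x == v) || o x v)) ->
    connect E u v.
  move=> ouv nI; apply: connect_sub (connect_covers treelike_irr o_tr ouv).
  move=> p q /and3P[cpq leup leqv]; have /andP[opq _] := cpq; apply: connect1.
  rewrite /E /= /edge /= /hasse_edge cpq /= andbT.
  have nepq : p != q by apply: contraTneq opq => ->; rewrite treelike_irr.
  rewrite nepq /=; apply/eqP => eqpq; case/negP: nI.
  have := set21 p q; have := set22 p q; rewrite eqpq !inE.
  case/orP=> /eqP qE /orP[] /eqP pE; subst; rewrite ?eqxx // in nepq *.
    by rewrite (treelike_asym opq) in oa'x.
  by rewrite leup leqv.
have nxd : ~~ ((x == d) || o x d).
  apply/negP => /orP[/eqP xd|oxd].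
    by move: lexb; rewrite xd eq_sym (negPf nebd) (negPf nodb).
  have oxb : o x b.
    by case/orP: lexb => [/eqP xb|//]; rewrite xb (negPf nobd) in oxd.
  by have := maxa' x; rewrite oxb oxd oa'x => /(_ isT).
(* The leg to [d] avoids [a'x] since [x <= d] fails, the two legs at [c] since [c <= a'] fails, and
   the last since [x <= a'] fails. *)
apply: (@connect_trans _ _ d); first by apply: conn; rewrite // negb_and nxd orbT.
apply: (@connect_trans _ _ c).
  by rewrite E_sym; apply: conn; rewrite // (negPf nca') (negPf noca').
apply: (@connect_trans _ _ b).
  by apply: conn; rewrite // (negPf nca') (negPf noca').
case/orP: lexb => [/eqP->|oxb]; first exact: connect0.
rewrite E_sym; apply: conn; rewrite // (treelike_asym oa'x) orbF.
by apply: contraTN oa'x => /andP[/eqP-> _]; rewrite treelike_irr.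
Qed.

End TreelikeOrientation.

Definition square (G : sgraph) (a b c d : G) : Prop :=
  [/\ [/\ edge a b, edge b c, edge c d & edge d a],
      ~~ edge a c, ~~ edge b d, a != c & b != d].

(** A directed path of length two along the square would give a diagonal by transitivity. Hence
    directions alternate, and one diagonal pair lies below the other. *)
Lemma square_center (G : sgraph) (o : rel G) a b c d :
  treelike_orientation o -> square a b c d ->
  exists r, [/\ o a r, o c r, o r b & o r d] \/ [/\ o b r, o d r, o r a & o r c].
Proof.
move=> to [[eab ebc ecd eda] nac nbd neac nebd].
have E := treelike_edgeE to; have tr := treelike_trans to.
have [nac' nbd'] := (nac, nbd).
rewrite !E in eab ebc ecd eda nac' nbd'.
rewrite !negb_or in nac' nbd'.
case/andP: nac' => /negP noac /negP noca.
case/andP: nbd' => /negP nobd /negP nodb.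
case/orP: eab => [oab|oba].
  have ocb : o c b by case/orP: ebc => // /(tr _ _ _ oab).
  have ocd : o c d by case/orP: ecd => // odc; case: nodb; apply: tr ocb.
  have oad : o a d by case/orP: eda => // /(tr _ _ _ ocd).
  have [r ?] := crossing_has_center to oab ocb ocd oad nac nbd neac nebd.
  by exists r; left.
have obc : o b c by case/orP: ebc => // ocb; case: noca; apply: tr oba.
have odc : o d c by case/orP: ecd => // /(tr _ _ _ obc).
have oda : o d a by case/orP: eda => // oad; case: noac; apply: tr odc.
rewrite edge_sym in nac; rewrite eq_sym in neac.
have [r [? ? ? ?]] := crossing_has_center to obc odc oda oba nbd nac nebd neac.
by exists r; right.
Qed.

Lemma induced_isomorphicP (G H : sgraph) :
  (exists S : {set G}, isomorphic (induced S) H) <->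
  (exists2 f : H -> G, injective f & forall x y, edge (f x) (f y) = edge x y).
Proof.
split=> [[S [f [g fK gK] ef]]|[f f_inj ef]].
  exists (fun x => val (g x)) => [x y /val_inj /(can_inj gK)//|x y].
  by rewrite -[in RHS](gK x) -[in RHS](gK y) ef.
have fS x : f x \in [set f y | y in H] by apply: imset_f.
have g_bij : bijective (fun x => Sub (f x) (fS x) : induced [set f y | y in H]).
  apply: inj_card_bij => [x y []/f_inj//|].
  by rewrite card_sig card_imset.
exists [set f y | y in H]; case: g_bij => g gK Kg.
exists g => [|x y]; first by exists (fun x => Sub (f x) (fS x)).
by rewrite -ef -[in RHS](Kg x) -[in RHS](Kg y).
Qed.

Lemma induced_C4P (G : sgraph) :
  (exists S : {set G}, isomorphic (induced S) C4) <->
  exists a b c d : G, square a b c d.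
Proof.
apply: (iff_trans (induced_isomorphicP G C4)); split=> [[f f_inj ef]|].
  pose v i : G := f (inord i : 'I_4).
  exists (v 0), (v 1), (v 2), (v 3).
  rewrite /square /v !ef !(inj_eq f_inj) -!(inj_eq val_inj) /= /edge /= /C4_edge.
  by rewrite !inordK.
move=> [a [b [c [d [[eab ebc ecd eda] nac nbd neac nebd]]]]].
(* The default [a] is never reached, since [i] is below 4. *)
pose f (i : C4) := nth a [:: a; b; c; d] i.
have neq x y : @edge G x y -> x != y.
  by apply: contraTneq => ->; rewrite edge_irr.
have uniq_f : uniq [:: a; b; c; d].
  by rewrite /= !inE !negb_or neac nebd !neq // edge_sym.
exists f => [i j /eqP|].
  by rewrite /f nth_uniq ?ltn_ord // => /eqP/val_inj.
case=> [[|[|[|[|//]]]] Hi] [[|[|[|[|//]]]] Hj];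
  rewrite /f /= ?edge_irr ?eab ?ebc ?ecd ?eda //;
  rewrite ?(negPf nac) ?(negPf nbd) // edge_sym ?eab ?ebc ?ecd ?eda //;
  by rewrite ?(negPf nac) ?(negPf nbd).
Qed.

Lemma is_rootP (G : sgraph) (r : G) :
  is_root r <-> forall x, x != r -> edge r x.
Proof.
split=> [rt x nexr|rt].
  by have := in_setT x; rewrite rt !inE (negPf nexr).
by apply/setP=> x; rewrite !inE; have [|/rt->] := eqVneq x r.
Qed.

(** On a cycle, the edge [xy] contains [r]. If [r] is [x], the next edge misses it; if [r] is [y],
    the previous one does. *)
Lemma star_acyclic (G : sgraph) (r : G) :
  (forall x y, edge x y -> (x == r) || (y == r)) -> acyclic G.
Proof.
move=> star [|x [|y [|z p]]] // _ /andP[+ uniq_p].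
rewrite (cycle_path x) /= => /and4P[elx exy eyz _].
move: uniq_p => /=; rewrite !inE !negb_or.
case/and4P=> /and3P[nexy nexz _] /andP[neyz ny] _ _.
case/orP: (star _ _ exy) => /eqP E; subst.
  by case/orP: (star _ _ eyz) => /eqP E; rewrite E ?eqxx // in nexy nexz.
case/orP: (star _ _ elx) => /eqP E; last by rewrite E eqxx in nexy.
by have := mem_last z p; rewrite E inE (negPf neyz) (negPf ny).
Qed.

(** * The wheel over a square *)

Section Wheel.
Variables (G : sgraph) (o : rel G) (a b c d r : G).
Hypotheses (to : treelike_orientation o) (sq : square a b c d).
Hypotheses (oar : o a r) (ocr : o c r) (orb : o r b) (ord : o r d).

Let S : {set G} := [set x in [:: r; a; b; c; d]].

Let oS : rel (induced S) := fun x y => o (val x) (val y).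

Lemma wheel_mem (x : induced S) :
  [\/ val x = r, val x = a | [\/ val x = b, val x = c | val x = d]].
Proof.
by have := valP x; rewrite !inE => /or4P[|||/orP[]] /eqP->; do ?constructor.
Qed.

(** The Hasse diagram is a star at [r]: every other vertex is comparable to [r], and a related pair
    avoiding [r] has [r] strictly between, so it is not a cover. *)
Lemma wheel_treelike : treelike_orientation oS.
Proof.
have irr := treelike_irr to; have tr := treelike_trans to.
have trS : transitive oS by move=> y x z; apply: tr.
have irrS : irreflexive oS by move=> x; apply: irr.
have rS : r \in S by rewrite !inE eqxx.
pose r' : induced S := Sub r rS.
have cmp (x : induced S) : x != r' -> oS x r' || oS r' x.
  rewrite -(inj_eq val_inj) /oS /=.
  by case: (wheel_mem x) => [->|->|[->|->|->]];
    rewrite ?eqxx ?oar ?ocr ?orb ?ord ?orbT.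
have crossing (x y : induced S) : oS x y ->
    [|| x == r', y == r' | oS x r' && oS r' y].
  have [_ nac nbd _ _] := sq.
  rewrite !(treelike_edgeE to) !negb_or in nac nbd.
  case/andP: nac => noac noca; case/andP: nbd => nobd nodb.
  rewrite -!(inj_eq val_inj) /oS /=.
  have n1 := treelike_asym to (tr _ _ _ oar orb).
  have n2 := treelike_asym to (tr _ _ _ oar ord).
  have n3 := treelike_asym to (tr _ _ _ ocr orb).
  have n4 := treelike_asym to (tr _ _ _ ocr ord).
  by case: (wheel_mem x) => [->|->|[->|->|->]];
    case: (wheel_mem y) => [->|->|[->|->|->]];
    rewrite ?eqxx ?orbT ?irr ?oar ?ocr ?orb ?ord ?orbT //
      ?(negPf noac) ?(negPf noca) ?(negPf nobd) ?(negPf nodb)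
      ?n1 ?n2 ?n3 ?n4.
split; [split=> // | split].
- split=> x y; first exact: (treelike_edgeE to (val x) (val y)).
  by apply/negP=> /andP[oxy]; rewrite /oS (treelike_asym to oxy).
- split=> [|x y]; first by apply/card_gt0P; exists r'.
  have conn s t : oS s t -> connect (hasse_edge oS) s t.
    move=> ost; apply: connect_sub (connect_covers irrS trS ost).
    move=> u v /and3P[cuv _ _]; apply: connect1; rewrite /hasse_edge cuv andbT.
    by case/andP: cuv => ouv _; apply: contraTneq ouv => ->; rewrite irrS.
  have Hsym : connect_sym (hasse_edge oS).
    exact: sym_connect_sym (hasse_edge_sym oS).
  have toC z : connect (hasse_edge oS) z r'.
    have [->|/cmp/orP[/conn//|/conn]] := eqVneq z r'; first exact: connect0.
    by rewrite Hsym.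
  by apply: connect_trans (toC x) _; rewrite Hsym.
- apply: (@star_acyclic (hasse_diagram oS) r') => x y.
  have cov (s t : induced S) : covers oS s t -> (s == r') || (t == r').
    case/andP=> ost /existsP nbt; case/or3P: (crossing _ _ ost) => [->|->|srt] //.
      by rewrite orbT.
    by case: nbt; exists r'.
  by case/andP=> _ /orP[/cov//|/cov]; rewrite orbC.
Qed.

Lemma wheel_strict : strict_double_arborescence (induced S).
Proof.
have [[eab ebc ecd eda] nac nbd neac nebd] := sq.
have E := treelike_edgeE to.
have [aS bS cS dS] : [/\ a \in S, b \in S, c \in S & d \in S].
  by rewrite !inE !eqxx !orbT.
have rS : r \in S by rewrite !inE eqxx.
split.
  split; first by exists oS; apply: wheel_treelike.
  exists (Sub r rS); apply/is_rootP => x; rewrite -(inj_eq val_inj) /=.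
  rewrite /edge /= /induced_edge /= E.
  by case: (wheel_mem x) => [->|->|[->|->|->]];
    rewrite ?eqxx ?oar ?ocr ?orb ?ord ?orbT.
case=> _ [o' [r' [to' /is_rootP rt src]]].
have sq' : @square (induced S) (Sub a aS) (Sub b bS) (Sub c cS) (Sub d dS) by [].
(* Each vertex of the square misses its opposite one, so only [r] can be a root. *)
have r'E : val r' = r.
  have adj s (sS : s \in S) : s != val r' -> edge (val r') s.
    by move=> nes; apply: (rt (Sub s sS)); rewrite -(inj_eq val_inj).
  case: (wheel_mem r') => [//|r'E|[] r'E]; move: adj; rewrite r'E.
  - by move/(_ c cS); rewrite eq_sym (negPf nac) neac => /(_ isT).
  - by move/(_ d dS); rewrite eq_sym (negPf nbd) nebd => /(_ isT).
  - by move/(_ a aS); rewrite edge_sym (negPf nac) neac => /(_ isT).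
  - by move/(_ b bS); rewrite edge_sym (negPf nbd) nebd => /(_ isT).
(* The centre of the square under [o'] is strictly related to all four vertices, so it is [r], which
   thus has both a predecessor and a successor. *)
have [q q_center] := square_center to' sq'.
have qE : q = r'.
  apply/val_inj; rewrite r'E; have irr' := treelike_irr to'.
  by case: (wheel_mem q) => [//|qE|[] qE];
    [have {}qE : q = Sub a aS | have {}qE : q = Sub b bS
    |have {}qE : q = Sub c cS | have {}qE : q = Sub d dS];
    try exact: val_inj; move: q_center; rewrite qE !irr' => -[] [].
have not_source z : o' z r' -> ~ source o' r'.
  by move=> ozr /cards0_eq/setP/(_ z); rewrite !inE ozr.
have not_sink z : o' r' z -> ~ sink o' r'.
  by move=> orz /cards0_eq/setP/(_ z); rewrite !inE orz.
rewrite qE in q_center.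
by case: q_center => -[o1 _ o2 _]; case: src;
  [apply: not_source o1|apply: not_sink o2|apply: not_source o1|apply: not_sink o2].
Qed.

End Wheel.

Lemma square_strict (G : sgraph) (a b c d : G) :
  treelike_comparability_graph G -> square a b c d ->
  exists S : {set G}, strict_double_arborescence (induced S).
Proof.
move=> [o to] sq; have [r [[o1 o2 o3 o4]|[o1 o2 o3 o4]]] := square_center to sq.
  by eexists; apply: (wheel_strict to sq o1 o2 o3 o4).
(* Rotating the square by one vertex exchanges the lower and the upper pair. *)
have sq' : square b c d a.
  case: sq => [[eab ebc ecd eda] nac nbd neac nebd].
  by split=> //; rewrite 1?edge_sym 1?eq_sym.
by eexists; apply: (wheel_strict to sq' o1 o2 o4 o3).
Qed.

(** * From a strict-double-arborescence to a square *)

Lemma chain_extremal_root (G : sgraph) (o : rel G) (r : G) :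
  irreflexive o -> transitive o -> (forall x y, edge x y = o x y || o y x) ->
  is_root r ->
  (forall x y, o x r -> o y r -> x != y -> edge x y) ->
  exists2 m, is_root m & forall z, o z m = false.
Proof.
move=> irr tr E /is_rootP rt chain.
(* A minimal [m] at or below [r] is adjacent to everything above [r] by transitivity and to
   everything below [r] by the chain condition. *)
have [m [_ lemr minm]] := exists_minimal_below irr tr (P := predT) (x := r) isT.
exists m; last by move=> z; apply/negbTE/minm.
apply/is_rootP => z nezm.
case/orP: lemr => [/eqP mr|omr]; first by rewrite mr; apply: rt; rewrite -mr.
have [->|/rt] := eqVneq z r; first by rewrite E omr.
rewrite E => /orP[orz|ozr]; first by rewrite E (tr _ _ _ omr orz).
by apply: chain; rewrite // eq_sym.
Qed.

Lemma strict_square (G : sgraph) : strict_double_arborescence G ->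
  exists a b c d : G, square a b c d.
Proof.
move=> [DA nA]; have [[o to] [r rt]] := DA.
have irr := treelike_irr to; have tr := treelike_trans to.
have E := treelike_edgeE to.
(* A boolean form, so that its failure yields a nonadjacent pair. *)
pose comparable_in (P : pred G) :=
  [forall x, forall y, [==> P x, P y, x != y => edge x y]].
have [downC|/forallPn[a /forallPn[c]]] := boolP (comparable_in (o^~ r)).
  have chain x y : o x r -> o y r -> x != y -> edge x y.
    move=> oxr oyr nexy.
    by have /forallP/(_ x)/forallP/(_ y) := downC; rewrite oxr oyr nexy.
  have [m rtm minm] := chain_extremal_root irr tr E rt chain.
  case: nA; split=> //; exists o, m; split=> //; left.
  by apply/eqP; rewrite cards_eq0; apply/eqP/setP=> z; rewrite !inE minm.
rewrite !negb_imply => /and4P[oar ocr neac nac].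
have [upC|/forallPn[b /forallPn[d]]] := boolP (comparable_in (o r)).
  have chain x y : o r x -> o r y -> x != y -> edge x y.
    move=> orx ory nexy.
    by have /forallP/(_ x)/forallP/(_ y) := upC; rewrite orx ory nexy.
  have E' x y : edge x y = o y x || o x y by rewrite E orbC.
  have tr' : transitive (fun x y => o y x) by move=> y x z oyx ozy; apply: tr oyx.
  (* In the reversed order the minimal root becomes a sink of [o]. *)
  have [m rtm maxm] := @chain_extremal_root G (fun x y => o y x) r irr tr' E' rt chain.
  case: nA; split=> //; exists o, m; split=> //; right.
  by apply/eqP; rewrite cards_eq0; apply/eqP/setP=> z; rewrite !inE maxm.
rewrite !negb_imply => /and4P[orb ord nebd nbd].
(* Through [r], both lower elements lie below both upper ones. *)
exists a, b, c, d; split=> //; rewrite !E.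
by rewrite (tr _ _ _ oar orb) (tr _ _ _ oar ord) (tr _ _ _ ocr orb)
  (tr _ _ _ ocr ord) !orbT.
Qed.

Theorem theorem5 (G : sgraph) (HG : treelike_comparability_graph G) :
  ~ (exists S : {set G}, isomorphic (induced S) C4) <->
  ~ (exists S : {set G}, strict_double_arborescence (induced S)).
Proof.
split=> nex; last first.
  by move=> /induced_C4P[a [b [c [d sq]]]]; apply: nex; apply: square_strict sq.
move=> [S /strict_square[a [b [c [d sq]]]]]; apply/nex/induced_C4P.
(* Adjacency in an induced subgraph is that of [G], so the square carries over. *)
by exists (val a), (val b), (val c), (val d).
Qed.
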